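(* Let $\mathbf H_1=(\mathbf G_1,F_1)$ and $\mathbf H_2=(\mathbf G_2,F_2)$ be $F$-sup-semilattices, $\mathbf L$ a sup-semilattice and $f\colon\mathbf H_1\to\mathbf H_2$ a lax morphism of $F$-sup-semilattices. Then there exists a homomorphism of frames $\mathbf J[f,\mathbf L]\colon\mathbf J[\mathbf H_2,\mathbf L]\to\mathbf J[\mathbf H_1,\mathbf L]$ such that $$(\mathbf J[f,\mathbf L](\alpha))(x)=\alpha(f(x))=(\alpha\circ f)(x)$$ for all $\alpha\in T_{[\mathbf H_2,\mathbf L]}$ and all $x\in G_1$. Moreover, $\mathbf J[-,\mathbf L]$ (sending $\mathbf H$ to $\mathbf J[\mathbf H,\mathbf L]$ and $f$ to $\mathbf J[f,\mathbf L]$) is a contravariant functor from the category of $F$-sup-semilattices and lax morphisms to the category of frames and frame homomorphisms.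
   Context: A sup-semilattice is a poset in which every subset has a join; morphisms of sup-semilattices are maps preserving arbitrary joins. An $F$-sup-semilattice is a pair $(\mathbf G,F)$ where $\mathbf G$ is a sup-semilattice and $F\colon G\to G$ preserves arbitrary joins. A lax morphism of $F$-sup-semilattices $(\mathbf G_1,F_1)\to(\mathbf G_2,F_2)$ is a sup-semilattice morphism $f$ with $F_2(f(x))\leq f(F_1(x))$ for all $x\in G_1$. A frame $\mathbf J=(T,S)$ is a set $T$ with a binary relation $S\subseteq T^2$; a homomorphism of frames $(T_1,S_1)\to(T_2,S_2)$ is a map $t\colon T_1\to T_2$ such that $(i,j)\in S_1$ implies $(t(i),t(j))\in S_2$. For an $F$-sup-semilattice $\mathbf H=(\mathbf G,F)$ and a sup-semilattice $\mathbf L$, the frame $\mathbf J[\mathbf H,\mathbf L]=(T_{[\mathbf H,\mathbf L]},S_{[\mathbf H,\mathbf L]})$ has $T_{[\mathbf H,\mathbf L]}$ equal to the set of all sup-semilattice morphisms $\mathbf G\to\mathbf L$, and $(\alpha,\beta)\in S_{[\mathbf H,\mathbf L]}$ iff $\beta(x)\leq\alpha(F(x))$ for all $x\in G$. *)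

(* Defs.v *)
From mathcomp Require Import all_boot all_order.
From mathcomp Require Import boolp classical_sets.

Set Implicit Arguments.
Unset Strict Implicit.
Unset Printing Implicit Defensive.

Import Order.TTheory.
Local Open Scope order_scope.
Local Open Scope classical_set_scope.

(* "Every subset" includes set0, so there is a least element.  The display is
   bundled so that all sup-semilattices form a single type of objects. *)
Record supSemilattice := SupSemilattice {
  sup_disp : Order.disp_t;
  sup_sort :> porderType sup_disp;
  sup_exists : forall A : set sup_sort, exists s, isLub A s
}.

(* As joins are unique and always exist in the source, this says
   f (sup A) = sup (f @` A) for every subset A. *)
Definition preserves_joins (G1 G2 : supSemilattice) (f : G1 -> G2) : Prop :=
  forall (A : set G1) (s : G1), isLub A s -> isLub (f @` A) (f s).

Record supHom (G1 G2 : supSemilattice) := SupHom {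
  supHom_fun :> G1 -> G2;
  supHom_joins : preserves_joins supHom_fun
}.

Record fSupSemilattice := FSupSemilattice {
  fsup_sort :> supSemilattice;
  fsup_op : supHom fsup_sort fsup_sort
}.

Record laxHom (H1 H2 : fSupSemilattice) := LaxHom {
  laxHom_hom :> supHom H1 H2;
  laxHom_lax : forall x : H1,
    fsup_op H2 (laxHom_hom x) <= laxHom_hom (fsup_op H1 x)
}.

Record frame := Frame {
  frame_sort :> Type;
  frame_rel : frame_sort -> frame_sort -> Prop
}.

Record frameHom (J1 J2 : frame) := FrameHom {
  frameHom_fun :> J1 -> J2;
  frameHom_rel : forall i j : J1,
    frame_rel i j -> frame_rel (frameHom_fun i) (frameHom_fun j)
}.

Definition frameJ (H : fSupSemilattice) (L : supSemilattice) : frame :=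
  @Frame (supHom H L)
    (fun alpha beta => forall x : H, beta x <= alpha (fsup_op H x)).

Record category := Category {
  obj : Type;
  hom : obj -> obj -> Type;
  idm : forall a, hom a a;
  compm : forall a b c, hom b c -> hom a b -> hom a c;
  compm_idl : forall a b (f : hom a b), compm (idm b) f = f;
  compm_idr : forall a b (f : hom a b), compm f (idm a) = f;
  compmA : forall a b c d (h : hom c d) (g : hom b c) (f : hom a b),
    compm h (compm g f) = compm (compm h g) f
}.

Definition contravariant_functor (C D : category) (F0 : obj C -> obj D)
    (F1 : forall a b : obj C, hom a b -> hom (F0 b) (F0 a)) : Prop :=
  (forall a : obj C, F1 a a (idm a) = idm (F0 a)) /\
  (forall (a b c : obj C) (g : hom b c) (f : hom a b),
     F1 a c (compm g f) = compm (F1 a b f) (F1 b c g)).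

Lemma supHom_ext (G1 G2 : supSemilattice) (f g : supHom G1 G2) :
  f =1 g -> f = g.
Proof.
case: f g => [f fP] [g gP] /= /funext fg; subst g.
by congr SupHom; exact: Prop_irrelevance.
Qed.

Lemma laxHom_ext (H1 H2 : fSupSemilattice) (f g : laxHom H1 H2) :
  f =1 g -> f = g.
Proof.
case: f g => [f fP] [g gP] /= /supHom_ext fg; subst g.
by congr LaxHom; exact: Prop_irrelevance.
Qed.

Lemma frameHom_ext (J1 J2 : frame) (f g : frameHom J1 J2) : f =1 g -> f = g.
Proof.
case: f g => [f fP] [g gP] /= /funext fg; subst g.
by congr FrameHom; exact: Prop_irrelevance.
Qed.

Lemma preserves_joins_id (G : supSemilattice) : preserves_joins (@id G).
Proof. by move=> A s; rewrite image_id. Qed.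

Lemma preserves_joins_comp (G1 G2 G3 : supSemilattice)
  (g : supHom G2 G3) (f : supHom G1 G2) : preserves_joins (g \o f).
Proof.
move=> A s lubs; rewrite -image_comp.
by apply: supHom_joins; exact: supHom_joins.
Qed.

Definition supHom_id (G : supSemilattice) : supHom G G :=
  SupHom (@preserves_joins_id G).

Definition supHom_comp (G1 G2 G3 : supSemilattice)
    (g : supHom G2 G3) (f : supHom G1 G2) : supHom G1 G3 :=
  SupHom (preserves_joins_comp g f).

Lemma supHom_mono (G1 G2 : supSemilattice) (f : supHom G1 G2) (x y : G1) :
  x <= y -> f x <= f y.
Proof.
move=> xy; have lub : isLub [set x; y] y.
  by split=> [z [->|->]//|b]; apply; right.
by have [ub _] := supHom_joins f lub; apply: ub; exists x => //; left.
Qed.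

Lemma laxHom_id_lax (H : fSupSemilattice) (x : H) :
  fsup_op H (supHom_id H x) <= supHom_id H (fsup_op H x).
Proof. exact: lexx. Qed.

Lemma laxHom_comp_lax (H1 H2 H3 : fSupSemilattice)
    (g : laxHom H2 H3) (f : laxHom H1 H2) (x : H1) :
  fsup_op H3 (supHom_comp g f x) <= supHom_comp g f (fsup_op H1 x).
Proof.
apply: le_trans (laxHom_lax g (f x)) _.
by apply: supHom_mono; exact: laxHom_lax.
Qed.

Definition laxHom_id (H : fSupSemilattice) : laxHom H H :=
  LaxHom (@laxHom_id_lax H).

Definition laxHom_comp (H1 H2 H3 : fSupSemilattice)
    (g : laxHom H2 H3) (f : laxHom H1 H2) : laxHom H1 H3 :=
  LaxHom (laxHom_comp_lax g f).

Definition frameHom_id (J : frame) : frameHom J J :=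
  @FrameHom J J id (fun _ _ ij => ij).

Definition frameHom_comp (J1 J2 J3 : frame)
    (g : frameHom J2 J3) (f : frameHom J1 J2) : frameHom J1 J3 :=
  @FrameHom J1 J3 (g \o f)
    (fun _ _ ij => frameHom_rel g (frameHom_rel f ij)).

Definition fSupLaxCat : category.
Proof.
apply: (@Category fSupSemilattice laxHom laxHom_id laxHom_comp) => *;
  exact: laxHom_ext.
Defined.

Definition frameCat : category.
Proof.
apply: (@Category frame frameHom frameHom_id frameHom_comp) => *;
  exact: frameHom_ext.
Defined.

(* Main.v *)
Require Import Defs.
From mathcomp Require Import all_boot all_order.
From mathcomp Require Import boolp classical_sets.

Import Order.TTheory.

(** [J[f,L]] is precomposition with [f]. If [alpha] is related to [beta], then [beta (f x) <= alpha
    (F2 (f x)) <= alpha (f (F1 x))]: the first inequality is the relation taken at [f x], the second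
    is laxness of [f] pushed through [alpha], which is monotone because it preserves joins.
    Functoriality is then the unit and associativity laws of composition. *)

Lemma frameJ_precomp_rel (H1 H2 : fSupSemilattice) (L : supSemilattice)
    (f : laxHom H1 H2) (alpha beta : frameJ H2 L) :
  frame_rel alpha beta ->
  @frame_rel (frameJ H1 L) (supHom_comp alpha f) (supHom_comp beta f).
Proof.
move=> ab x; apply: le_trans (ab (f x)) _.
by apply: supHom_mono; exact: laxHom_lax.
Qed.

(** [L] comes first so that [frameJ_map L] is by itself the arrow part of the functor. *)
Definition frameJ_map (L : supSemilattice) (H1 H2 : fSupSemilattice)
    (f : laxHom H1 H2) : frameHom (frameJ H2 L) (frameJ H1 L) :=
  @FrameHom (frameJ H2 L) (frameJ H1 L) (fun alpha => supHom_comp alpha f)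
    (@frameJ_precomp_rel H1 H2 L f).

Theorem theorem3p10 :
  (forall (H1 H2 : fSupSemilattice) (L : supSemilattice) (f : laxHom H1 H2),
     exists Jf : frameHom (frameJ H2 L) (frameJ H1 L),
       forall (alpha : supHom H2 L) (x : H1),
         (Jf alpha : supHom H1 L) x = alpha (f x) /\
         alpha (f x) = (alpha \o f) x) /\
  (forall L : supSemilattice,
     exists JL : forall H1 H2 : fSupSemilattice,
         laxHom H1 H2 -> frameHom (frameJ H2 L) (frameJ H1 L),
       (forall (H1 H2 : fSupSemilattice) (f : laxHom H1 H2)
               (alpha : supHom H2 L) (x : H1),
          (JL H1 H2 f alpha : supHom H1 L) x = alpha (f x)) /\
       @contravariant_functor fSupLaxCat frameCat
         (fun H : fSupSemilattice => frameJ H L) JL).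
Proof.
split=> [H1 H2 L f|L]; first by exists (frameJ_map L H1 H2 f).
exists (frameJ_map L); split=> //.
(* Both laws hold by computation once applied to [alpha] and to a point; extensionality at the two
   levels disposes of the proof components. *)
by split=> [H|H1 H2 H3 g f]; apply: frameHom_ext => alpha; exact: supHom_ext.
Qed.
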